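(* Every DP-good graph belongs to $DP^*$.
   Context: All graphs are finite and simple. For a graph $G$ and $m\in\mathbb{N}$, a cover of $G$ is a pair $\mathcal{H}=(L,H)$ where $H$ is a graph and $L$ maps each vertex of $G$ to a subset of $V(H)$ such that: $\{L(u):u\in V(G)\}$ is a partition of $V(H)$; each $H[L(u)]$ is complete; if $u,v$ are non-adjacent in $G$ there are no edges of $H$ between $L(u)$ and $L(v)$; and for each edge $uv\in E(G)$ the edges of $H$ between $L(u)$ and $L(v)$ form a matching. The cover is $m$-fold if $|L(v)|=m$ for all $v$. An $\mathcal{H}$-coloring of $G$ is an independent set of $H$ of size $|V(G)|$; $P_{DP}(G,\mathcal{H})$ is the number of $\mathcal{H}$-colorings, and $P(G,m)$ is the chromatic polynomial (number of proper colorings $V(G)\to[m]$). Let $\mathcal{H}_{G,m}=(L_{G,m},H_{G,m})$ be the $m$-fold cover with $L_{G,m}(u)=\{(u,i):i\in[m]\}$ and, for each edge $uv\in E(G)$, the edges between $L_{G,m}(u)$ and $L_{G,m}(v)$ being exactly $\{(u,i)(v,i):i\in[m]\}$. $DP^*$ is the set of graphs $G$ for which there exists $M\in\mathbb{N}$ such that for every integer $m\ge M$ and every $m$-fold cover $\mathcal{H}=(L,H)$ of $G$ with $H\not\cong H_{G,m}$, we have $P_{DP}(G,\mathcal{H})>P(G,m)$. For an edge $e$ of $G$, let $\mathcal{C}_G(e)$ be the set of cycles of $G$ containing $e$ of minimum length, and let the girth $\ell_G(e)$ of $e$ be the length of the cycles in $\mathcal{C}_G(e)$ if this set is nonempty,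 and $\ell_G(e)=\infty$ otherwise. A graph $G$ is DP-good if $G$ has a spanning tree $T$ and a labeling $e_1,\dots,e_q$ of the edges of $E(G)\setminus E(T)$ (where $q=|E(G)|-|E(T)|$) such that $\ell_G(e_1)\le\cdots\le\ell_G(e_q)$ and for each $i\in[q]$, $\ell_G(e_i)$ is odd and there is some $C_i\in\mathcal{C}_G(e_i)$ with $E(C_i)\subseteq E(T)\cup\{e_1,\dots,e_i\}$. *)

(* Defs.v *)
From HB Require Import structures.
From mathcomp Require Import all_boot.
Set Implicit Arguments.
Unset Strict Implicit.
Unset Printing Implicit Defensive.

Record sgraph := SGraph {
  vert :> finType;
  adj : rel vert;
  adj_sym : symmetric adj;
  adj_irrefl : irreflexive adj }.

(* An edge uv is the two-element set [set u; v]. *)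
Definition edges (G : sgraph) : {set {set G}} :=
  [set [set x; y] | x in [set: G], y in [set: G] & adj x y].

Definition edges_between (G : sgraph) (A B : {set G}) : {set {set G}} :=
  [set [set x; y] | x in A, y in B & adj x y].

Definition complete_on (G : sgraph) (A : {set G}) : Prop :=
  {in A &, forall x y : G, x != y -> adj x y}.

Definition independent (G : sgraph) (A : {set G}) : bool :=
  [forall x in A, forall y in A, ~~ adj x y].

(* [trivIset M]: distinct members of M are disjoint. *)
Definition matching (G : sgraph) (M : {set {set G}}) : Prop :=
  M \subset edges G /\ trivIset M.

Definition isomorphic (G H : sgraph) : Prop :=
  exists2 f : G -> H, bijective f & forall x y : G, adj (f x) (f y) = adj x y.

(* The sets L u are indexed by the vertices u: distinct vertices have distinct,
   hence disjoint, lists, which [partition] of the image set alone does not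
   say. *)
Record is_cover (G H : sgraph) (L : G -> {set H}) : Prop := IsCover {
  cover_inj : injective L;
  cover_partition : partition [set L u | u : G] [set: H];
  cover_complete : forall u : G, complete_on (L u);
  cover_nonadj : forall u v : G,
    u != v -> ~~ adj u v -> edges_between (L u) (L v) = set0;
  cover_adj : forall u v : G, adj u v -> matching (edges_between (L u) (L v)) }.

Definition fold_cover (m : nat) (G H : sgraph) (L : G -> {set H}) : Prop :=
  is_cover L /\ forall u : G, #|L u| = m.

Definition is_coloring (G H : sgraph) (L : G -> {set H}) (I : {set H}) : bool :=
  independent I && (#|I| == #|G|).

Definition P_DP (G H : sgraph) (L : G -> {set H}) : nat :=
  #|[set I : {set H} | is_coloring L I]|.

Definition proper (G : sgraph) (m : nat) (c : {ffun G -> 'I_m}) : bool :=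
  [forall u, forall v, adj u v ==> (c u != c v)].

Definition P_chrom (G : sgraph) (m : nat) : nat :=
  #|[set c : {ffun G -> 'I_m} | proper c]|.

Section CanonicalCover.
Variables (G : sgraph) (m : nat).

Definition canonical_adj : rel (G * 'I_m) :=
  fun p q => ((p.1 == q.1) && (p.2 != q.2)) || (adj p.1 q.1 && (p.2 == q.2)).

Lemma canonical_adj_sym : symmetric canonical_adj.
Proof.
by move=> p q; rewrite /canonical_adj adj_sym (eq_sym p.1) (eq_sym p.2).
Qed.

Lemma canonical_adj_irrefl : irreflexive canonical_adj.
Proof. by move=> p; rewrite /canonical_adj adj_irrefl !eqxx. Qed.

Definition canonical_graph : sgraph :=
  SGraph canonical_adj_sym canonical_adj_irrefl.

Definition canonical_list (u : G) : {set canonical_graph} :=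
  [set (u, i) | i : 'I_m].

Lemma mem_canonical_list (u : G) (p : G * 'I_m) :
  (p \in canonical_list u) = (p.1 == u).
Proof.
apply/imsetP/eqP => [[i _ ->] //|<-]; exists p.2 => //; exact: surjective_pairing.
Qed.

Lemma canonical_fold_cover : 0 < m -> fold_cover m canonical_list.
Proof.
move=> m0; pose i0 := Ordinal m0.
have inL u i : (u, i) \in canonical_list u by rewrite mem_canonical_list.
split; last by move=> u; rewrite card_imset ?card_ord // => i j [].
split.
- move=> u v E; apply/eqP; rewrite -(mem_canonical_list v (u, i0)) -E; exact: inL.
- apply/and3P; split.
  + apply/eqP/setP => p; rewrite inE; apply/bigcupP; exists (canonical_list p.1).
      exact: imset_f.
    by rewrite mem_canonical_list.
  + apply/trivIsetP => _ _ /imsetP[u _ ->] /imsetP[v _ ->] neq.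
    rewrite -setI_eq0; apply/eqP/setP => p; rewrite !inE !mem_canonical_list.
    by apply/negbTE/negP => /andP[/eqP eu /eqP ev]; rewrite -eu -ev eqxx in neq.
  + by apply/imsetP => -[u _ E]; move: (inL u i0); rewrite -E inE.
- move=> u [a i] [b j]; rewrite !mem_canonical_list /= => /eqP-> /eqP->.
  by rewrite /canonical_adj /= eqxx xpair_eqE eqxx /= => ->.
- move=> u v uv nadj; apply/setP => E; rewrite inE; apply/negbTE/negP.
  case/imset2P => -[a i] [b j]; rewrite !inE !mem_canonical_list /=.
  move=> /eqP-> /andP[/eqP->].
  by rewrite /canonical_adj /= (negbTE uv) (negbTE nadj).
- move=> u v uv; split.
    by apply/subsetP => E /imset2P[x y _]; rewrite inE => /andP[_ xy] ->;
      apply/imset2P; exists x y; rewrite ?inE.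
  have nuv : u != v by apply/negP => /eqP E; rewrite E adj_irrefl in uv.
  have edgeE E : E \in edges_between (canonical_list u) (canonical_list v) ->
      exists i, E = [set (u, i); (v, i)].
    case/imset2P => -[a i] [b j]; rewrite !inE !mem_canonical_list /=.
    move=> /eqP-> /andP[/eqP->].
    rewrite /canonical_adj /= (negbTE nuv) uv /= => /eqP-> ->.
    by exists j.
  apply/trivIsetP => _ _ /edgeE[i ->] /edgeE[j ->] neq.
  have nij : i != j by apply: contraNneq neq => ->.
  rewrite -setI_eq0; apply/eqP/setP => -[a k]; rewrite !inE !xpair_eqE.
  by have [->|_] := eqVneq k i; rewrite ?(negbTE nij) !andbF.
Qed.

End CanonicalCover.

Definition DP_star (G : sgraph) : Prop :=
  exists M : nat, forall m : nat, M <= m ->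
  forall (H : sgraph) (L : G -> {set H}), fold_cover m L ->
  ~ isomorphic H (canonical_graph G m) ->
  P_chrom G m < P_DP L.

(* A cycle is given by a cyclic list of its (distinct) vertices; its length is
   the size of that list. *)
Definition is_cycle (G : sgraph) (c : seq G) : bool :=
  (2 < size c) && ucycleb (@adj G) c.

Definition cycle_edges (G : sgraph) (c : seq G) : {set {set G}} :=
  [set [set x; next c x] | x in c].

Definition cycle_through (G : sgraph) (e : {set G}) (c : seq G) : bool :=
  is_cycle c && (e \in cycle_edges c).

Definition shortest_cycle (G : sgraph) (e : {set G}) (c : seq G) : Prop :=
  cycle_through e c /\
  forall c' : seq G, cycle_through e c' -> size c <= size c'.

(* [None] stands for infinity; the bound #|G| on the length loses nothing, as
   [edge_girthP] and [edge_girth_inf] show. *)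
Definition edge_girth (G : sgraph) (e : {set G}) : option nat :=
  ohead [seq n <- iota 0 #|G|.+1 | [exists t : n.-tuple G, cycle_through e t]].

Definition girth_le (a b : option nat) : bool :=
  match a, b with
  | _, None => true
  | None, Some _ => false
  | Some k, Some l => k <= l
  end.

Definition girth_odd (a : option nat) : bool :=
  if a is Some n then odd n else false.

Lemma mem_edge_girth_seq (G : sgraph) (e : {set G}) (c : seq G) :
  cycle_through e c ->
  size c \in [seq n <- iota 0 #|G|.+1 | [exists t : n.-tuple G, cycle_through e t]].
Proof.
move=> ce; rewrite mem_filter mem_iota /= add0n ltnS; apply/andP; split.
  by apply/existsP; exists (in_tuple c).
case/andP: ce => /andP[_ /andP[_ /card_uniqP <-]] _; exact: max_card.
Qed.

Lemma edge_girthP (G : sgraph) (e : {set G}) (c : seq G) :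
  shortest_cycle e c -> edge_girth e = Some (size c).
Proof.
case=> ce minc; have := mem_edge_girth_seq ce; rewrite /edge_girth.
set s := filter _ _.
have srt : sorted leq s by apply: sorted_filter (iota_sorted _ _); exact: leq_trans.
have lb n : n \in s -> size c <= n.
  by rewrite mem_filter => /andP[/existsP[t /minc]]; rewrite size_tuple.
case: s srt lb => //= n s srt lb; rewrite inE => cs; congr Some; apply/eqP.
rewrite eqn_leq lb ?mem_head // andbT.
case/orP: cs => [/eqP-> //|cs].
by have /allP := order_path_min leq_trans srt; apply.
Qed.

Lemma edge_girth_inf (G : sgraph) (e : {set G}) :
  (forall c : seq G, ~~ cycle_through e c) -> edge_girth e = None.
Proof.
move=> no; rewrite /edge_girth (@eq_filter _ _ pred0) ?filter_pred0 // => n.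
by apply/existsP => -[t]; rewrite (negbTE (no t)).
Qed.

Section SpanningSubgraph.
Variables (G : sgraph) (F : {set {set G}}).

Definition spanning_adj : rel G := fun x y => (x != y) && ([set x; y] \in F).

Lemma spanning_adj_sym : symmetric spanning_adj.
Proof. by move=> x y; rewrite /spanning_adj eq_sym setUC. Qed.

Lemma spanning_adj_irrefl : irreflexive spanning_adj.
Proof. by move=> x; rewrite /spanning_adj eqxx. Qed.

Definition spanning_subgraph : sgraph :=
  SGraph spanning_adj_sym spanning_adj_irrefl.

End SpanningSubgraph.

Definition connected (G : sgraph) : Prop := forall x y : G, connect (@adj G) x y.

Definition acyclic (G : sgraph) : Prop := forall c : seq G, ~~ is_cycle c.

Definition is_tree (G : sgraph) : Prop := connected G /\ acyclic G.

(* A spanning tree is identified with its edge set. *)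
Definition spanning_tree (G : sgraph) (F : {set {set G}}) : Prop :=
  F \subset edges G /\ is_tree (spanning_subgraph F).

(* The labels 1, ..., q are shifted to 0, ..., q - 1. *)
Definition DP_good (G : sgraph) : Prop :=
  exists F : {set {set G}}, spanning_tree F /\
  let q := #|edges G| - #|F| in
  exists e : 'I_q -> {set G},
  [/\ injective e,
      [set e i | i : 'I_q] = edges G :\: F,
      forall i j : 'I_q, i <= j -> girth_le (edge_girth (e i)) (edge_girth (e j))
    & forall i : 'I_q,
        girth_odd (edge_girth (e i)) /\
        exists2 C : seq G, shortest_cycle (e i) C &
          cycle_edges C \subset F :|: [set e j | j : 'I_q & j <= i]].

(* Main.v *)
Require Import Defs.
From mathcomp Require Import fingroup perm all_boot ssralg ssrnum ssrint zify.

Set Implicit Arguments.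
Unset Strict Implicit.
Unset Printing Implicit Defensive.

(** Extend the matchings of an m-fold cover to permutations [s x y] of the
    colours, and relabel the lists so that they are trivial on the spanning
    tree.  If all of them are trivial, the cover is a proper subgraph of the
    canonical one, and a missing edge admits an additional colouring.  Otherwise
    inclusion-exclusion over the edge sets A gives
      P_DP - P >= sum_A (-1)^(|A|+1) t(A),
    where t(A) >= 0 is the number of maps constant on the components of A minus
    the number of maps f with f y = s x y (f x) along A.  With d(e) the number
    of colours moved by s on e, l(e) the girth of e and n the order of G, put
    w(e) = d(e) m^(n - l(e)).  Let W be the sum of the w(e).
    If |A| is even then m t(A) <= W: a set A containing a cycle through e meets
    at least l(e) + 1 vertices unless A is a shortest cycle through e, which has
    odd length when d(e) > 0.  On the other hand
    t(C_j) >= w(e_j) - sum_(k < j) w(e_k), hence some C_j has t(C_j) >= W / 2^q,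
    which beats the 2^|E| even terms as soon as m > 2^q 2^|E|. *)

(** * Finite combinatorics *)

Lemma set2_inj (T : finType) (x y z w : T) :
  [set x; y] = [set z; w] -> (x = z /\ y = w) \/ (x = w /\ y = z).
Proof.
move=> E; have := set21 x y; have := set22 x y; have := set21 z w.
have := set22 z w; rewrite -{1 2}E {3 4}E !inE.
by case/orP=> /eqP hw; case/orP=> /eqP hz; case/orP=> /eqP hy;
   case/orP=> /eqP hx; subst; auto.
Qed.

Lemma card_bigcup_le (I T : finType) (P : pred I) (F : I -> {set T}) :
  #|\bigcup_(i | P i) F i| <= \sum_(i | P i) #|F i|.
Proof.
elim/big_rec2: _ => [|i n A _ le_An]; first by rewrite cards0.
by apply: leq_trans (leq_card_setU _ _) _; rewrite leq_add2l.
Qed.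

(** A union bound over fibres. The factor [k] stands in for a division: it is [m] for even edge sets
    and 1 for cycles. *)
Lemma card_fiber_le (I T : finType) (S : {set T}) (v : T -> I) (X : {set I}) k b :
  (forall i, i \in X -> k * #|[set f in S | v f == i]| <= b) ->
  k * #|[set f in S | v f \in X]| <= #|X| * b.
Proof.
move=> h; pose F i := [set f in S | v f == i].
have sub : [set f in S | v f \in X] \subset \bigcup_(i in X) F i.
  apply/subsetP => f; rewrite inE => /andP[fS fX]; apply/bigcupP.
  by exists (v f); rewrite // inE fS eqxx.
apply: leq_trans (leq_mul (leqnn k) (leq_trans (subset_leq_card sub) (card_bigcup_le _ _))) _.
by rewrite big_distrr -sum_nat_const /=; apply: leq_sum.
Qed.

(** Overwriting the values on [K] by colour 0 is injective on [S], and the results are supported off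
    [K]. *)
Lemma card_determined_off (V : finType) m (K : {set V}) (S : {set {ffun V -> 'I_m}}) :
  0 < m ->
  {in S &, forall f g : {ffun V -> 'I_m}, (forall x, x \notin K -> f x = g x) -> f = g} ->
  #|S| <= m ^ (#|V| - #|K|).
Proof.
case: m S => // m S _ inj.
pose h (f : {ffun V -> 'I_m.+1}) := [ffun x => if x \in K then ord0 else f x].
have injh : {in S &, injective h}.
  move=> f g fS gS /ffunP E; apply: inj => // x xK.
  by have := E x; rewrite !ffunE (negbTE xK).
rewrite -(card_in_imset injh).
have -> : #|V| - #|K| = #|~: K| by rewrite (cardsCs (~: K)) setCK.
have <- : #|pffun_on ord0 (mem (~: K)) (mem [set: 'I_m.+1])| = m.+1 ^ #|~: K|.
  by rewrite card_pffun_on cardsT card_ord.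
apply: subset_leq_card; apply/subsetP => _ /imsetP[f _ ->].
apply/pffun_onP; split; last by move=> i _; rewrite inE.
apply/subsetP => x; rewrite !inE /= ffunE; by case: (x \in K); rewrite ?eqxx.
Qed.

(** For fixed [f], expand the product over [E] of 1 minus the indicator of [P f e], then sum over
    [f]. *)
Lemma inclusion_exclusion (T U : finType) (E : {set U}) (P : T -> U -> bool) :
  (#|[set f | [forall e in E, ~~ P f e]]|%:Z =
   \sum_(A : {set U} | A \subset E)
      (-1) ^+ #|A| * #|[set f | [forall e in A, P f e]]|%:Z)%R.
Proof.
have prodb f (A : {set U}) :
    (\prod_(e in A) (P f e)%:Z = [forall e in A, P f e]%:Z)%R.
  case: (boolP [forall e in A, P f e]) => [/forall_inP h|].
    by rewrite big1 // => e /h ->.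
  by case/forall_inPn => e eA /negbTE h; rewrite (bigD1 e) //= h GRing.mul0r.
have ie f : ([forall e in E, ~~ P f e]%:Z =
    \sum_(A : {set U} | A \subset E) (-1) ^+ #|A| * [forall e in A, P f e]%:Z)%R.
  (* The product runs over the whole type so that [bigA_distr] applies; the factor of an [e] outside
     [E] is 1. *)
  transitivity (\prod_e (- ((e \in E) && P f e)%:Z + 1))%R.
    case: (boolP [forall e in E, ~~ P f e]) => [/forall_inP h|].
      rewrite big1 // => e _; case: (boolP (e \in E)) => [/h/negbTE->|_] //=;
      by rewrite GRing.oppr0 GRing.add0r.
    case/forall_inPn => e eE; rewrite negbK => pe.
    by rewrite (bigD1 e) //= eE pe GRing.addNr GRing.mul0r.
  rewrite bigA_distr [RHS]big_mkcond /=; apply: eq_big => [A|A _]; first by rewrite inE.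
  rewrite -(big_mkcond (fun e => e \in A)).
  case: (boolP (A \subset E)) => [/subsetP sA | /subsetPn[e eA /negbTE eE]].
    rewrite -prodb -GRing.prodrN; apply: eq_bigr => e /sA ->; by [].
  by rewrite (bigD1 e) //= eE GRing.oppr0 GRing.mul0r.
have cz (p : pred T) : (#|[set f | p f]|%:Z = \sum_f (p f)%:Z)%R.
  rewrite -sum1dep_card big_mkcond /= -[LHS]/(Posz _) (big_morph Posz PoszD (erefl _)).
  by apply: eq_bigr => f _; case: (p f).
rewrite cz (eq_bigr _ (fun f _ => ie f)) exchange_big /=.
by apply: eq_bigr => A _; rewrite cz GRing.mulr_sumr.
Qed.

(** Let [j] maximise [t] and let S(r) be the sum of the first r weights. As S(r+1) <= t_r + 2 S(r),
    the quantity S(r) + t_j at most doubles at each step, starting from t_j. *)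
Lemma exists_dominant (q : nat) (w t : 'I_q -> nat) :
  (forall j : 'I_q, w j <= t j + \sum_(k < q | k < j) w k) ->
  0 < \sum_j w j -> exists j : 'I_q, \sum_k w k <= 2 ^ q * t j.
Proof.
move=> h w0.
have q0 : 0 < q by case: q w t h w0 => // w t h; rewrite big_ord0.
pose j0 := Ordinal q0; exists [arg max_(j > j0) t j].
case: arg_maxnP => //= j _ maxj.
have ind r : r <= q -> \sum_(k < q | k < r) w k + t j <= 2 ^ r * t j.
  elim: r => [|r IH] rq; first by rewrite big_pred0 ?mul1n.
  have -> : \sum_(k < q | k < r.+1) w k = w (Ordinal rq) + \sum_(k < q | k < r) w k.
    rewrite (bigD1 (Ordinal rq)) //=; congr (_ + _); apply: eq_bigl => k.
    by rewrite -val_eqE /=; lia.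
  have := IH (ltnW rq); have := h (Ordinal rq); have := maxj (Ordinal rq) isT.
  rewrite expnS /=; nia.
apply: leq_trans (ind q (leqnn q)); rewrite (eq_bigl _ _ (fun k => ltn_ord k)).
exact: leq_addr.
Qed.

(** The points of the domain are treated one by one: following [s] by the transposition of [s i] and
    [j] corrects the value at [i], and injectivity of [R] preserves the earlier values. *)
Lemma perm_extend (T : finType) (R : T -> T -> bool) :
  (forall i j j', R i j -> R i j' -> j = j') ->
  (forall i i' j, R i j -> R i' j -> i = i') ->
  exists s : {perm T}, forall i j, R i j -> s i = j.
Proof.
move=> fn inj; pose S := [set i | [exists j, R i j]].
suff [s hs] : exists s : {perm T}, forall i j, i \in enum S -> R i j -> s i = j.
  by exists s => i j Rij; apply: hs => //; rewrite mem_enum inE; apply/existsP; exists j.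
elim: (enum S) => [|i r [s hs]]; first by exists 1%g.
case: (boolP (i \in r)) => [ir|ir].
  by exists s => k j; rewrite inE => /predU1P[->|]; apply: hs.
case: (boolP [exists j, R i j]) => [/existsP[j Rij]|/existsPn no]; last first.
  exists s => k j; rewrite inE => /predU1P[->|]; last exact: hs.
  by rewrite (negbTE (no j)).
exists (s * tperm (s i) j)%g => k l; rewrite inE permM => /predU1P[->|kr] Rkl.
  by rewrite tpermL; apply: fn Rij Rkl.
have nki : k != i by apply: contraNneq ir => <-.
have skl := hs k l kr Rkl; rewrite tpermD //.
  by rewrite (inj_eq perm_inj) eq_sym.
by apply: contraNneq nki => E; apply/eqP; apply: inj Rkl _; rewrite -skl -E.
Qed.

(** * Edge sets, paths and cycles *)

(** Serves to show that a walk around a cycle does not use the edge that closes it. *)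
Lemma path_neq_last (T : eqType) (r : rel T) x p :
  uniq (x :: p) -> path r x p ->
  path [rel a b | r a b && (a != last x p)] x p.
Proof.
elim: p x => //= y p IH x /and3P[xyp yp up] /andP[rxy py].
rewrite rxy /= IH ?yp ?py ?andbT //=.
by apply: contraNneq xyp => ->; apply: mem_last.
Qed.

Section EdgeSets.
Variable G : sgraph.
Implicit Types (A B : {set {set G}}) (c p : seq G) (x y : G).

Lemma spanning_adj_subset A B : A \subset B -> subrel (spanning_adj A) (spanning_adj B).
Proof. by move=> /subsetP AB x y /andP[xy /AB]; rewrite /spanning_adj xy. Qed.

Lemma mem_edges x y : ([set x; y] \in edges G) = adj x y.
Proof.
apply/imset2P/idP => [[a b _]|xy]; last by exists x y; rewrite ?inE.
rewrite inE => /andP[_ ab] /set2_inj[[-> ->] //|[-> ->]]; by rewrite adj_sym.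
Qed.

Lemma adj_neq x y : adj x y -> x != y.
Proof. by apply: contraTneq => ->; rewrite adj_irrefl. Qed.

Lemma spanning_adj_edges x y : spanning_adj (edges G) x y = adj x y.
Proof. by rewrite /spanning_adj mem_edges; apply: andb_idl; apply: adj_neq. Qed.

Lemma edgesP e : e \in edges G -> exists x y, adj x y /\ e = [set x; y].
Proof. by case/imset2P => x y _; rewrite inE => /andP[_ xy] ->; exists x, y. Qed.

Lemma spanning_connect_sym A : connect_sym (spanning_adj A).
Proof. apply: sym_connect_sym; exact: spanning_adj_sym. Qed.

Lemma spanning_adjD1 A e x y :
  spanning_adj (A :\ e) x y = spanning_adj A x y && ([set x; y] != e).
Proof. by rewrite /spanning_adj in_setD1 andbCA andbC. Qed.

Lemma next_last (x : G) p : uniq (x :: p) -> next (x :: p) (last x p) = x.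
Proof.
move=> up; have : x :: p = rcons (belast x p) (last x p) by rewrite -lastI.
move: (belast x p) => s Es.
have E : rot (size s) (x :: p) = last x p :: s by rewrite {1}Es -cats1 rot_size_cat.
rewrite -(next_rot (size s)) // E.
by case: s Es {E} => [|b s] [<-] //= _; rewrite eqxx.
Qed.

Lemma closing_cycle A x p :
  spanning_adj A x (last x p) -> uniq (x :: p) ->
  path (spanning_adj (A :\ [set x; last x p])) x p ->
  [/\ 2 < size (x :: p), cycle (spanning_adj A) (x :: p)
    & [set x; last x p] \in cycle_edges (x :: p)].
Proof.
move=> xy up pp; split.
(* The path avoids the closing edge, so it is not a single step. *)
- case: p xy pp {up} => [|y [|z p]] //=; first by rewrite /spanning_adj eqxx.
  by rewrite spanning_adjD1 eqxx !andbF.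
- rewrite /= rcons_path spanning_adj_sym xy andbT.
  by apply: sub_path pp => a b; rewrite spanning_adjD1 => /andP[].
- apply/imsetP; exists (last x p); first exact: mem_last.
  rewrite setUC; congr [set _; _].
  by rewrite next_last.
Qed.

Lemma cycle_edges_subset A c : cycle (spanning_adj A) c -> cycle_edges c \subset A.
Proof.
move=> cc; apply/subsetP => _ /imsetP[x xc ->].
by have /andP[] := next_cycle cc xc.
Qed.

(** Two vertices with the same cycle edge would be each other's successors, which a cycle of length
    above 2 excludes. *)
Lemma cycle_edge_inj c : uniq c -> 2 < size c ->
  {in c &, injective (fun x => [set x; next c x])}.
Proof.
move=> uc sc x y xc yc /set2_inj[[]//|[xE yE]].
have [i s cE] := rot_to xc.
move: (uc) (sc); rewrite -(rot_uniq i) -(size_rot i) cE => ur.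
move: xE yE; rewrite -!(next_rot i uc) cE.
case: s ur {cE} => [|a [|b s]] //= /and3P[]; rewrite !inE !negb_or.
move=> /and3P[/negbTE xa /negbTE xb _] _ _; rewrite eqxx => xE yE _.
by move: xE xb; rewrite -yE eq_sym xa eqxx => ->; rewrite eqxx.
Qed.

Lemma card_cycle_edges c : uniq c -> 2 < size c -> #|cycle_edges c| = size c.
Proof.
by move=> uc sc; rewrite card_in_imset; [apply/card_uniqP | apply: cycle_edge_inj].
Qed.

(** With [e] joining [z] to its successor, rotate the cycle to start at that successor: it then ends
    at [z], and its other edges differ from [e] by [cycle_edge_inj]. *)
Lemma cycle_edge_path c e : is_cycle c -> e \in cycle_edges c ->
  exists x p, [/\ perm_eq c (x :: p), e = [set x; last x p]
                & path (spanning_adj (cycle_edges c :\ e)) x p].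
Proof.
move=> /andP[sc /andP[cc uc]] /imsetP[z zc eE].
have yc : next c z \in c by rewrite mem_next.
have [i p cE] := rot_to yc; set y := next c z in eE cE.
have pc : perm_eq c (y :: p) by rewrite -cE perm_sym perm_rot.
have uy : uniq (y :: p) by rewrite -(perm_uniq pc).
have nE : next c =1 next (y :: p) by move=> a; rewrite -cE next_rot.
have zE : last y p = z.
  by apply: (can_inj (prev_next uy)); rewrite next_last // -nE.
exists y, p; split=> //; first by rewrite zE setUC.
have : path [rel a b | (frel (next (y :: p)) a b) && (a != last y p)] y p.
  apply: path_neq_last => //.
  by have := cycle_next uy; rewrite /= rcons_path => /andP[].
have cP : all (mem c) (y :: p) by apply/allP => a; rewrite -(perm_mem pc).
apply: (sub_in_path (P := mem c)) cP => a b ac bc /andP[/eqP ab az].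
have ab' : [set a; b] = [set a; next c a] by rewrite -ab -nE.
rewrite spanning_adjD1 /spanning_adj -andbA; apply/and3P; split.
- by apply: adj_neq; rewrite -ab -nE; apply: next_cycle.
- by rewrite ab'; apply/imsetP; exists a.
- apply: contraNneq az; rewrite zE ab' eE => E.
  by apply/eqP/(cycle_edge_inj uc sc).
Qed.

(* Otherwise the chord shortcuts the path, and the shorter path closes to a
   shorter cycle through the same edge. *)
Lemma no_chord A x p a b :
  uniq (x :: p) -> path (spanning_adj (A :\ [set x; last x p])) x p ->
  (forall p', path (spanning_adj (A :\ [set x; last x p])) x p' ->
     last x p' = last x p -> size p <= size p') ->
  [set x; last x p] \in cycle_edges (x :: p) ->
  a \in x :: p -> b \in x :: p -> spanning_adj A a b ->
  [set a; b] \in cycle_edges (x :: p).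
Proof.
move=> up pp minp eC.
have main a' b' p1 p2 : p = p1 ++ p2 -> a' = last x p1 -> b' \in p2 ->
    spanning_adj A a' b' -> [set a'; b'] \in cycle_edges (x :: p).
  move=> pE aE bp2; case/splitPr: bp2 pE => p3 p4 pE ab.
  have [->//|abe] := eqVneq [set a'; b'] [set x; last x p].
  case: p3 pE => [|d p3] pE.
    apply/imsetP; exists a'; first by rewrite pE aE -cat_cons mem_cat mem_last.
    congr [set _; _].
    have Es : x :: p1 = rcons (belast x p1) a' by rewrite aE -lastI.
    move: (belast x p1) Es => s Es.
    have E : rot (size s) (x :: p) = a' :: b' :: p4 ++ s.
      by rewrite pE -cat_cons Es cat_rcons rot_size_cat.
    by rewrite -(next_rot (size s)) // E /= eqxx.
  have shorter : ~~ (size p <= size (p1 ++ b' :: p4)).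
    by rewrite pE !(size_cat, =^~ cat_cons) /=; lia.
  case/negP: shorter; apply: minp; last by rewrite pE !last_cat.
  move: pp; set r := spanning_adj _; rewrite pE !cat_path -aE => /andP[-> /=].
  by case/andP=> _ /andP[_ ->]; rewrite /r spanning_adjD1 ab abe.
move=> ax bx ab.
have [p1 [p2 [pE aE]]] : exists p1 p2, p = p1 ++ p2 /\ last x p1 = a.
  by case/splitPl: ax => p1 p2 aE; exists p1, p2.
have : b \in x :: p1 ++ p2 by rewrite -pE.
rewrite -cat_cons mem_cat => /orP[bp1|bp2]; last exact: (main a b p1 p2 pE (esym aE) bp2 ab).
case/splitPl: bp1 pE aE => p3 p4 bE pE aE; rewrite setUC.
apply: (main b a p3 (p4 ++ p2)); first by rewrite catA.
- by rewrite bE.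
- rewrite mem_cat -aE last_cat bE; case: p4 {pE} aE => [|d p4] /=.
    by rewrite cats0 bE => E; move: ab; rewrite -E /spanning_adj eqxx.
  by rewrite mem_last.
- by rewrite spanning_adj_sym.
Qed.

End EdgeSets.

(** * Gains and flat sections *)

Section Gains.
Variables (G : sgraph) (m : nat).
Implicit Types (s : G -> G -> {perm 'I_m}) (f g : {ffun G -> 'I_m}).
Implicit Types (A C F : {set {set G}}) (e : {set G}) (x y : G) (i : 'I_m).

(** The convention of gain (voltage) graphs: traversing an edge backwards inverts its
    permutation. *)
Definition gain s := forall x y, s y x = (s x y)^-1%g.

(** Quantifying over both orientations makes this depend on the unordered edge only; for a gain the
    two conditions are equivalent. *)
Definition agrees s f e :=
  [forall x, forall y, (x != y) && (e == [set x; y]) ==> (f y == s x y (f x))].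

Definition flat s A := [set f | [forall e in A, agrees s f e]].

Definition gain1 (x y : G) : {perm 'I_m} := 1%g.

(** A permutation and its inverse move the same points, so for a gain both orientations of [e] give
    the same set. *)
Definition displ s e :=
  [set i | [exists x, exists y, [&& x != y, e == [set x; y] & s x y i != i]]].

Lemma flatP s A f :
  reflect (forall x y, spanning_adj A x y -> f y = s x y (f x)) (f \in flat s A).
Proof.
rewrite inE; apply: (iffP forall_inP) => [h x y /andP[xy /h]|h e eA].
  by move/forallP/(_ x)/forallP/(_ y); rewrite xy eqxx => /eqP.
apply/forallP => x; apply/forallP => y; apply/implyP => /andP[xy /eqP eE].
by apply/eqP/h; rewrite /spanning_adj xy -eE.
Qed.

Lemma agreesE s f x y : gain s -> x != y ->
  agrees s f [set x; y] = (f y == s x y (f x)).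
Proof.
move=> gs xy; apply/forallP/eqP => [/(_ x)/forallP/(_ y)|h a].
  by rewrite xy eqxx => /eqP.
apply/forallP => b; apply/implyP => /andP[_ /eqP/set2_inj[[<- <-]|[<- <-]]].
  exact/eqP.
by rewrite h gs permK.
Qed.

Lemma displE s x y i : gain s -> x != y -> (i \in displ s [set x; y]) = (s x y i != i).
Proof.
move=> gs xy; rewrite inE; apply/existsP/idP => [[a /existsP[b /and3P[_ /eqP E h]]]|h].
  case/set2_inj: E h => -[-> ->] //; apply: contra => /eqP h.
  by rewrite gs -{1}h permK.
by exists x; apply/existsP; exists y; rewrite xy eqxx.
Qed.

Lemma displ_neq0 s x y : gain s -> x != y -> s x y != 1%g -> displ s [set x; y] != set0.
Proof.
move=> gs xy; apply: contra => /eqP d0; apply/eqP/perm.permP => i; rewrite perm1.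
by apply/eqP; rewrite -[_ == _]negbK -displE // d0 inE.
Qed.

Lemma gain1_gain : gain gain1.
Proof. by move=> x y; rewrite /gain1 invg1. Qed.

Lemma flat_connect s A f g x y : f \in flat s A -> g \in flat s A ->
  connect (spanning_adj A) x y -> f x = g x -> f y = g y.
Proof.
move=> /flatP hf /flatP hg /connectP[p pp ->]; elim: p x pp => //= z p IH x /andP[xz pz] E.
by apply: IH => //; rewrite (hf x z) // (hg x z) // E.
Qed.

Lemma flat1_connect A f x y : f \in flat gain1 A ->
  connect (spanning_adj A) x y -> f x = f y.
Proof.
move=> /flatP hf /connectP[p pp ->]; elim: p x pp => //= z p IH x /andP[xz pz].
by rewrite -IH // (hf x z) // perm1.
Qed.

(** A flat section is determined by one value per component, so spreading its value at the root over
    each component is injective. *)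
Lemma card_flat_le s A : #|flat s A| <= #|flat gain1 A|.
Proof.
pose r := root (spanning_adj A); pose h f := [ffun x => f (r x)].
have csym := spanning_connect_sym A.
have inj : {in flat s A &, injective h}.
  move=> f g fA gA /ffunP E; apply/ffunP => x.
  apply: (flat_connect fA gA (x := r x)); first by rewrite csym connect_root.
  by have := E x; rewrite !ffunE.
rewrite -(card_in_imset inj); apply: subset_leq_card; apply/subsetP => _ /imsetP[f _ ->].
apply/flatP => x y xy; rewrite perm1 !ffunE; congr (f _); apply/eqP.
by rewrite root_connect // csym connect1.
Qed.

(** Switching by [g]: products act from left to right, so colour [i] at [x] now stands for the old
    colour [g x i]. *)
Definition regauge s (g : G -> {perm 'I_m}) x y := (g x * s x y * (g y)^-1)%g.

Lemma regauge_gain s (g : G -> {perm 'I_m}) : gain s -> gain (regauge s g).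
Proof. by move=> gs x y; rewrite /regauge gs !invMg invgK mulgA. Qed.

Lemma card_flat_regauge_le s (g : G -> {perm 'I_m}) A :
  #|flat (regauge s g) A| <= #|flat s A|.
Proof.
pose h f := [ffun x => g x (f x)].
have inj : injective h.
  by move=> f f' /ffunP E; apply/ffunP => x; have := E x; rewrite !ffunE => /perm_inj.
rewrite -(card_imset _ inj); apply: subset_leq_card.
apply/subsetP => _ /imsetP[f /flatP fA ->].
by apply/flatP => x y /fA E; rewrite !ffunE E !permM permKV.
Qed.

(** Induction on [F]. Deleting a bridge uv cuts [u] off from the component of [v]. Multiplying the
    gauge by a constant [h] on that component trivialises the gain of uv and only conjugates the
    gains inside it, so trivial ones stay trivial. *)
Lemma exists_gauge s A F : gain s -> F \subset A ->
  (forall x y, spanning_adj F x y -> ~~ connect (spanning_adj (A :\ [set x; y])) x y) ->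
  exists g : G -> {perm 'I_m},
    (forall x y, spanning_adj F x y -> regauge s g x y = 1%g) /\
    (forall x y, spanning_adj (A :\: F) x y -> g x = g y).
Proof.
move=> gs; have [n] := ubnP #|F|; elim: n A F => // n IH A F Fn FA br.
have [[u v] /= uv|no] := pickP (fun p : G * G => spanning_adj F p.1 p.2); last first.
  by exists (fun _ => 1%g); split=> // x y xy; have := no (x, y); rewrite /= xy.
set e := [set u; v]; have eF : e \in F by case/andP: uv.
have [|||g [gF gA]] := IH (A :\ e) (F :\ e).
- by move: Fn; rewrite (cardsD1 e) eF.
- exact: setSD.
- move=> x y; rewrite spanning_adjD1 => /andP[/br nc _]; apply: contra nc.
  apply: connect_sub => a b ab; apply: connect1; apply: spanning_adj_subset ab.
  by apply: setSD; apply: subD1set.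
have {}gA x y : spanning_adj (A :\: F) x y -> g x = g y.
  by move=> xy; apply: gA; congr (spanning_adj _ x y): xy; apply/setP => z; rewrite !inE;
     case: (z =P e) => [->|_] //=; rewrite eF.
pose K w := connect (spanning_adj (A :\ e)) v w.
have nKu : ~~ K u by rewrite /K spanning_connect_sym; apply: br.
have Kv : K v by apply: connect0.
(* The solution of g u * s u v * (h * g v)^-1 = 1. *)
pose h := (g u * s u v * (g v)^-1)%g.
have KA x y : spanning_adj (A :\ e) x y -> K x = K y.
  move=> xy; apply/idP/idP => k; apply: connect_trans k (connect1 _) => //.
  by rewrite spanning_adj_sym.
pose g' w := if K w then (h * g w)%g else g w.
have g'E x y : K x = K y -> regauge s g x y = 1%g -> regauge s g' x y = 1%g.
  rewrite /regauge /g' => <-; case: (K x) => // E.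
  have -> : (h * g x * s x y * (h * g y)^-1 = h * (g x * s x y * (g y)^-1) * h^-1)%g.
    by rewrite invMg !mulgA.
  by rewrite E mulg1 mulgV.
have g'uv : regauge s g' u v = 1%g.
  by rewrite /regauge /g' (negbTE nKu) Kv /h !(invMg, invgK) !mulgA !(mulgKV, mulgK) mulgV.
exists g'; split=> x y xy.
  have [/set2_inj[[-> ->] //|[-> ->]]|xye] := eqVneq [set x; y] e.
    by rewrite regauge_gain // g'uv invg1.
  have xyF : spanning_adj (F :\ e) x y by rewrite spanning_adjD1 xy.
  by apply: g'E (gF _ _ xyF); apply: KA; apply: spanning_adj_subset xyF; apply: setSD.
have xyA : spanning_adj (A :\ e) x y.
  apply: spanning_adj_subset xy; apply/subsetP => z; rewrite !inE => /andP[zF ->].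
  by rewrite andbT; apply: contraNneq zF => ->.
by rewrite /g' (gA _ _ xy) (KA _ _ xyA).
Qed.

End Gains.

(** * Defects *)

Section Defects.
Variables (G : sgraph) (m : nat).
Hypothesis m_gt0 : 0 < m.
Implicit Types (s : G -> G -> {perm 'I_m}) (f g : {ffun G -> 'I_m}).
Implicit Types (A C F : {set {set G}}) (e : {set G}) (x y : G) (i : 'I_m).

Local Notation gain1 := (@gain1 G m).

Lemma agrees_fix s e f x : gain s -> agrees s f e -> x \in e -> e \in edges G ->
  f x \notin displ s e -> agrees gain1 f e.
Proof.
move=> gs ag xe /edgesP[a [b [/adj_neq ab eE]]]; subst e.
move: ag; rewrite !agreesE //; last exact: gain1_gain.
rewrite displE // negbK perm1 => /eqP fb.
case/set2P: xe => ->; first by rewrite fb.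
by rewrite fb (inj_eq perm_inj) eq_sym.
Qed.

Lemma flat1_agrees s e f x : gain s -> agrees gain1 f e -> x \in e -> e \in edges G ->
  f x \notin displ s e -> agrees s f e.
Proof.
move=> gs ag xe /edgesP[a [b [/adj_neq ab eE]]]; subst e.
move: ag; rewrite !agreesE //; last exact: gain1_gain.
rewrite displE // negbK perm1 => /eqP fb.
by case/set2P: xe => ->; rewrite fb => /eqP->.
Qed.

(** A function constant along [A] but not flat for [s] takes, on some edge of [A], a colour moved
    there. The union bound runs over edges and moved colours, so edges with trivial gain cost
    nothing. *)
Lemma flat_defect_le_trivial_bridges s A k (B : {set G} -> nat) (v : {set G} -> G) :
  gain s -> A \subset edges G -> (forall e, e \in A -> v e \in e) ->
  (forall e i, e \in A -> i \in displ s e ->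
     k * #|[set f in flat gain1 A | f (v e) == i]| <= B e) ->
  k * #|flat gain1 A| <= k * #|flat s A| + \sum_(e in A) #|displ s e| * B e.
Proof.
move=> gs AE vA h.
pose Y e := [set f in flat gain1 A | f (v e) \in displ s e].
have sub : flat gain1 A \subset flat s A :|: \bigcup_(e in A) Y e.
  apply/subsetP => f fA; rewrite inE; apply/orP.
  case: (boolP (f \in flat s A)) => [|nf]; [by left|right].
  move: nf; rewrite inE => /forall_inPn[e eA nag]; apply/bigcupP; exists e => //.
  rewrite inE fA; apply: contraNT nag => nd.
  apply: (flat1_agrees gs _ (vA e eA)) => //; last exact: (subsetP AE).
  by move: fA; rewrite inE => /forall_inP; apply.
apply: leq_trans (leq_mul (leqnn k) (subset_leq_card sub)) _.
apply: leq_trans (leq_mul (leqnn k) (leq_card_setU _ _)) _.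
rewrite mulnDr leq_add2l; apply: leq_trans (leq_mul (leqnn k) (card_bigcup_le _ _)) _.
rewrite big_distrr /=; apply: leq_sum => e eA.
by apply: card_fiber_le => i; apply: h.
Qed.

(* Bridges do not contribute: a gauge makes their gains trivial and conjugates
   the other gains. *)
Lemma flat_defect_le s A k (B : {set G} -> nat) (v : {set G} -> G) :
  gain s -> A \subset edges G -> (forall e, e \in A -> v e \in e) ->
  (forall x y i, spanning_adj A x y -> s x y != 1%g ->
     connect (spanning_adj (A :\ [set x; y])) x y ->
     k * #|[set f in flat gain1 A | f x == i]| <= B [set x; y]) ->
  k * #|flat gain1 A| <= k * #|flat s A| + \sum_(e in A) #|displ s e| * B e.
Proof.
move=> gs AE vA h.
pose bridge e := [exists x, exists y, [&& x != y, e == [set x; y]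
                   & ~~ connect (spanning_adj (A :\ e)) x y]].
pose F := [set e in A | bridge e].
have csym := spanning_connect_sym.
have bridgeE x y : x != y ->
    bridge [set x; y] = ~~ connect (spanning_adj (A :\ [set x; y])) x y.
  move=> xy; apply/existsP/idP => [[a /existsP[b /and3P[_ /eqP E]]]|nc].
    by case/set2_inj: E => -[-> ->] //; rewrite csym.
  by exists x; apply/existsP; exists y; rewrite xy eqxx.
have FA : F \subset A by apply/subsetP => e; rewrite inE => /andP[].
have Fbr x y : spanning_adj F x y -> ~~ connect (spanning_adj (A :\ [set x; y])) x y.
  by case/andP=> xy; rewrite inE bridgeE // => /andP[].
have [g [gF gA]] := exists_gauge gs FA Fbr.
set s' := regauge s g in gF.
have gs' : gain s' by apply: regauge_gain.
have nonbridge x y : spanning_adj A x y -> displ s' [set x; y] != set0 ->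
    [/\ s x y != 1%g, connect (spanning_adj (A :\ [set x; y])) x y & g x = g y].
  move=> /andP[xy xyA] /set0Pn[i]; rewrite displE // => mv.
  have nF : [set x; y] \notin F.
    by apply: contra mv => xyF; rewrite gF ?perm1 // /spanning_adj xy.
  have gxy : g x = g y by apply: gA; rewrite /spanning_adj xy inE nF.
  split=> //; last by move: nF; rewrite inE xyA bridgeE // negbK.
  by apply: contra mv => /eqP E; rewrite /s' /regauge E gxy mulg1 mulgV perm1.
have le' : k * #|flat gain1 A| <= k * #|flat s' A| + \sum_(e in A) #|displ s' e| * B e.
  apply: (flat_defect_le_trivial_bridges gs' AE vA) => e i eA id.
  have [x [y [xy eE]]] := edgesP (subsetP AE e eA).
  have xyA : spanning_adj A x y by rewrite /spanning_adj adj_neq // -eE.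
  have dn0 : displ s' [set x; y] != set0 by apply/set0Pn; exists i; rewrite -eE.
  have [s1 cn _] := nonbridge x y xyA dn0.
  subst e; have /set2P[->|->] := vA _ eA; first exact: h.
  rewrite setUC; apply: h; first by rewrite spanning_adj_sym.
    by rewrite gs eq_invg1.
  by rewrite setUC csym.
apply: leq_trans le' _; apply: leq_add.
  by rewrite leq_mul2l card_flat_regauge_le orbT.
apply: leq_sum => e eA; rewrite leq_mul2r; apply/orP; right.
have [->|dn0] := eqVneq (displ s' e) set0; first by rewrite cards0.
have [x [y [xy eE]]] := edgesP (subsetP AE e eA).
have xyA : spanning_adj A x y by rewrite /spanning_adj adj_neq // -eE.
rewrite eE in dn0 *; have [_ _ gxy] := nonbridge x y xyA dn0.
rewrite -(card_imset _ (@perm_inj _ (g x))); apply: subset_leq_card.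
apply/subsetP => _ /imsetP[i + ->]; rewrite !displE ?adj_neq //.
by apply: contra => /eqP E; rewrite /s' /regauge !permM E gxy permK.
Qed.

(** A path from [x] to [y] avoiding the edge xy closes to a cycle on at least [l] vertices, where
    [f] is constantly [i]. One more determined vertex gains the factor [m]; its absence would make
    [A] a cycle of odd length [l]. *)
Lemma even_fiber_bound A x y l i :
  A \subset edges G -> spanning_adj A x y ->
  connect (spanning_adj (A :\ [set x; y])) x y ->
  (forall p, path (spanning_adj (A :\ [set x; y])) x p -> last x p = y ->
     l <= (size p).+1) ->
  odd l -> ~~ odd #|A| ->
  m * #|[set f in flat gain1 A | f x == i]| <= m ^ (#|G| - l).
Proof.
set e := [set x; y] => AE xyA cxy minp odd_l even_A.
pose S := [set f in flat gain1 A | f x == i].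
suff [K Kl det] : exists2 K : {set G}, l < #|K| &
    {in S &, forall f f' : {ffun G -> 'I_m}, (forall z, z \notin K -> f z = f' z) -> f = f'}.
  apply: leq_trans (leq_mul (leqnn m) (card_determined_off m_gt0 det)) _.
  rewrite -expnS leq_pexp2l //; have Kn : #|K| <= #|G| := max_card _.
  by move: #|K| #|G| Kl Kn; lia.
have [p [pp lp up]] : exists p,
    [/\ path (spanning_adj (A :\ e)) x p, last x p = y & uniq (x :: p)].
  by case/connectP: cxy => p0 /shortenP[p pp up _] ->; exists p.
have pA : path (spanning_adj A) x p.
  by apply: sub_path pp => a b; rewrite spanning_adjD1 => /andP[].
have Sc f z : f \in S -> z \in x :: p -> f z = i.
  rewrite inE => /andP[fA /eqP <-] zc; symmetry; apply: (flat1_connect fA).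
  exact: path_connect zc.
have lc := minp p pp lp; have cardc : #|[set z in x :: p]| = (size p).+1.
  by rewrite cardsE; have /card_uniqP -> := up.
have [ltl|gel] := ltnP l (size p).+1.
  exists [set z in x :: p]; first by rewrite cardc.
  move=> f f' fS f'S E; apply/ffunP => z.
  have [zc|zc] := boolP (z \in x :: p); first by rewrite !Sc.
  by apply: E; rewrite inE.
have lE : l = (size p).+1 by lia.
(* An edge with an end [z] off the cycle determines [f z] from [f w], where [w] lies on the cycle or
   outside [K]. *)
have [[z w] /= /andP[zw zc]|inc] :=
    pickP (fun q : G * G => spanning_adj A q.1 q.2 && (q.1 \notin x :: p)).
  exists (z |: [set z in x :: p]); first by rewrite cardsU1 inE zc cardc lE.
  move=> f f' fS f'S E.
  have Ew a : a != z -> f a = f' a.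
    move=> az; have [ac|ac] := boolP (a \in x :: p); first by rewrite !Sc.
    by apply: E; rewrite !inE negb_or az -in_cons ac.
  apply/ffunP => a; have [->|/Ew //] := eqVneq a z.
  move: fS f'S => /setIdP[/flatP fA _] /setIdP[/flatP f'A _].
  move: (zw); rewrite spanning_adj_sym => wz.
  by rewrite (fA w z) // (f'A w z) // !perm1 Ew // eq_sym; case/andP: zw.
subst y.
have [sc cc eC] := closing_cycle xyA up pp.
(* All edges of [A] now join cycle vertices, and minimality of the path excludes chords. *)
have AC : A = cycle_edges (x :: p).
  apply/eqP; rewrite eqEsubset cycle_edges_subset // andbT.
  apply/subsetP => a aA; have [u [v [uv aE]]] := edgesP (subsetP AE a aA).
  have uvA : spanning_adj A u v by rewrite /spanning_adj adj_neq // -aE.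
  have uc : u \in x :: p by apply: contraFT (inc (u, v)) => nu; rewrite /= uvA.
  have vc : v \in x :: p.
    by apply: contraFT (inc (v, u)) => nv; rewrite /= spanning_adj_sym uvA.
  rewrite aE; apply: (no_chord up pp) => // p' pp' lp'.
  by rewrite -ltnS -lE; apply: minp.
by move: even_A; rewrite AC card_cycle_edges // (_ : size _ = l) ?odd_l.
Qed.

(** * Lower bound for the defect of a cycle *)

Lemma cycle_edges_mem c x y : spanning_adj (cycle_edges c) x y ->
  (x \in c) && (y \in c).
Proof.
case/andP=> _ /imsetP[z zc /set2_inj[[-> ->]|[-> ->]]]; by rewrite mem_next zc.
Qed.

Lemma cycle_edges_edges c : is_cycle c -> cycle_edges c \subset edges G.
Proof.
case/andP=> _ /andP[cc _]; apply: cycle_edges_subset.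
by apply: sub_cycle cc => x y; rewrite spanning_adj_edges.
Qed.

(** Values off the cycle and at one vertex [x] of it are free; the value at [x] is then copied
    around the cycle. *)
Lemma card_flat1_cycle c : is_cycle c ->
  m * m ^ (#|G| - size c) <= #|flat gain1 (cycle_edges c)|.
Proof.
case/andP=> sc /andP[_ uc]; pose i0 := Ordinal m_gt0.
have [x xc] : exists x, x \in c by case: c sc {uc} => // x p; exists x; rewrite mem_head.
pose D := ~: ([set z in c] :\ x).
pose h f : {ffun G -> 'I_m} := [ffun z => if z \in c then f x else f z].
have cardD : m * m ^ (#|G| - size c) = #|pffun_on i0 (mem D) (mem [set: 'I_m])|.
  rewrite card_pffun_on cardsT card_ord -expnS; congr (m ^ _).
  have := cardsC D; rewrite setCK.
  have := cardsD1 x [set z in c]; rewrite inE xc cardsE (card_uniqP uc).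
  have := max_card (mem c); rewrite (card_uniqP uc).
  by move: #|D| #|_ :\ x| #|G| (size c); lia.
have inj : {in pffun_on i0 (mem D) (mem [set: 'I_m]) &, injective h}.
  move=> f g /pffun_onP[/subsetP fD _] /pffun_onP[/subsetP gD _] /ffunP E.
  apply/ffunP => z; have := E z; rewrite !ffunE; case: ifP => // zc fxgx.
  have [->//|zx] := eqVneq z x.
  have nD : z \notin mem D by rewrite !inE zx zc.
  have /eqP -> : f z == i0 by apply: contraNT nD; apply: fD.
  by apply/esym/eqP; apply: contraNT nD; apply: gD.
rewrite cardD -(card_in_imset inj); apply: subset_leq_card.
apply/subsetP => _ /imsetP[f _ ->]; apply/flatP => a b /cycle_edges_mem/andP[ac bc].
by rewrite !ffunE ac bc perm1.
Qed.

Lemma agrees_notin_displ s e f x : gain s -> e \in edges G -> x \in e ->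
  agrees s f e -> agrees gain1 f e -> f x \notin displ s e.
Proof.
move=> gs /edgesP[a [b [/adj_neq ab eE]]]; subst e => xe.
rewrite !agreesE //; last exact: gain1_gain.
rewrite displE // negbK perm1 => /eqP sab /eqP fab.
by case/set2P: xe => ->; rewrite ?fab -sab fab.
Qed.

(** Unless a flat section takes a moved colour on some edge other than [e], it is constant around
    the cycle, and closing up along [e] forces its colour to be fixed there. Each colour at a cycle
    vertex leaves at most m^(n - |c|) sections, and the trivial gain has at least m times as
    many. *)
Lemma cycle_defect_ge s c e (v : {set G} -> G) : gain s -> is_cycle c ->
  e \in cycle_edges c -> (forall e', e' \in cycle_edges c -> v e' \in e') ->
  #|displ s e| * m ^ (#|G| - size c) + #|flat s (cycle_edges c)| <=
    #|flat gain1 (cycle_edges c)| +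
    \sum_(e' in cycle_edges c :\ e) #|displ s e'| * m ^ (#|G| - size c).
Proof.
move=> gs cyc eC vC; set C := cycle_edges c in eC vC *; set b := m ^ _.
have CE : C \subset edges G by apply: cycle_edges_edges.
have [x [p [pc eE pp]]] := cycle_edge_path cyc eC.
have conn z : z \in c -> connect (spanning_adj (C :\ e)) x z.
  by rewrite (perm_mem pc); apply: path_connect.
have connC z w : z \in c -> w \in c -> connect (spanning_adj C) z w.
  move=> zc wc; have sub : subrel (spanning_adj (C :\ e)) (connect (spanning_adj C)).
    by move=> a d ad; apply/connect1/(spanning_adj_subset _ ad)/subD1set.
  apply: connect_trans (connect_sub sub (conn w wc)).
  by rewrite spanning_connect_sym; apply: connect_sub sub _ _ (conn z zc).
have vc e' : e' \in C -> v e' \in c.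
  move=> e'C; have := vC e' e'C; case/imsetP: e'C => z zc -> /set2P[->|->] //.
  by rewrite mem_next.
(* The cycle is connected, so one value on it determines the others. *)
have fiber e' i : e' \in C -> 1 * #|[set f in flat s C | f (v e') == i]| <= b.
  move=> e'C; rewrite mul1n /b.
  have uc : uniq c by case/andP: cyc => _ /andP[].
  have <- : #|[set z in c]| = size c by rewrite cardsE (card_uniqP uc).
  apply: card_determined_off => // f g /setIdP[fC /eqP fi] /setIdP[gC /eqP gi] E.
  apply/ffunP => z; have [zc|zc] := boolP (z \in c); last by apply: E; rewrite inE.
  by apply: (flat_connect fC gC (connC _ _ (vc _ e'C) zc)); rewrite fi gi.
pose Y e' := [set f in flat s C | f (v e') \in displ s e'].
have sub : flat s C \subset \bigcup_(e' in C :\ e) Y e' :|: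
    [set f in flat s C | f (v e) \in ~: displ s e].
  apply/subsetP => f fC; rewrite inE; apply/orP.
  have [fY|fY] := boolP (f \in \bigcup_(e' in C :\ e) Y e'); [by left|right].
  have ag e' : e' \in C -> agrees s f e' by move: fC; rewrite inE => /forall_inP; apply.
  have f1 : f \in flat gain1 (C :\ e).
    rewrite inE; apply/forall_inP => e' e'C; have /setD1P[_ e'C'] := e'C.
    apply: (agrees_fix gs (ag _ e'C') (vC _ e'C') (subsetP CE _ e'C')).
    apply: contra fY => fd; apply/bigcupP; exists e' => //.
    by rewrite inE fC fd.
  apply/setIdP; split=> //; rewrite inE.
  apply: (agrees_notin_displ gs (subsetP CE _ eC) (vC _ eC) (ag _ eC)).
  have /adj_neq xy : adj x (last x p) by rewrite -mem_edges -eE (subsetP CE).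
  rewrite {1}eE agreesE //; last exact: gain1_gain.
  rewrite perm1 eq_sym; apply/eqP; apply: (flat1_connect f1); apply: conn.
  by rewrite (perm_mem pc) mem_last.
have := subset_leq_card sub; have := leq_of_leqif (leq_card_setU (\bigcup_(e' in C :\ e) Y e')
  [set f in flat s C | f (v e) \in ~: displ s e]).
have := card_bigcup_le (mem (C :\ e)) Y.
have le1 : \sum_(e' in C :\ e) #|Y e'| <= \sum_(e' in C :\ e) #|displ s e'| * b.
  apply: leq_sum => e' /setD1P[_ e'C]; rewrite -[#|Y e'|]mul1n.
  by apply: card_fiber_le => i _; apply: fiber.
have le2 : #|[set f in flat s C | f (v e) \in ~: displ s e]| <= #|~: displ s e| * b.
  by rewrite -[X in X <= _]mul1n; apply: card_fiber_le => i _; apply: fiber.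
have := card_flat1_cycle cyc; rewrite -/C -/b.
have := cardsC (displ s e); rewrite card_ord => dE.
rewrite -{1}dE mulnDl; move: le1 le2; clear.
move: (#|_| * b) (#|~: _| * b) (\sum_(e' in _) #|Y e'|) (\sum_(e' in _) #|displ s e'| * b).
move: #|_ :|: _| #|[set f in _ | _]| #|\bigcup_(_ in _) _| #|flat s C| #|flat _ C|; lia.
Qed.

End Defects.

(** * Counting colourings by inclusion-exclusion over edge sets *)

Section Colorings.
Variables (G : sgraph) (m : nat).
Implicit Types (s : G -> G -> {perm 'I_m}) (C : {set {set G}}).

Local Notation gain1 := (@gain1 G m).

Definition colorings s :=
  [set f : {ffun G -> 'I_m} | [forall e in edges G, ~~ agrees s f e]].

Lemma colorings_inclusion_exclusion s :
  #|colorings s| + \sum_(A : {set {set G}} | (A \subset edges G) && odd #|A|) #|flat s A| =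
  \sum_(A : {set {set G}} | (A \subset edges G) && ~~ odd #|A|) #|flat s A|.
Proof.
have := inclusion_exclusion (edges G) (agrees s).
rewrite (bigID (fun A : {set {set G}} => odd #|A|)) /=.
have oddE : (\sum_(A : {set {set G}} | (A \subset edges G) && odd #|A|)
    (-1) ^+ #|A| * #|flat s A|%:Z = - (\sum_(A : {set {set G}} |
    (A \subset edges G) && odd #|A|) #|flat s A|)%:Z)%R.
  rewrite (big_morph Posz PoszD (erefl _)) -GRing.sumrN; apply: eq_bigr => A /andP[_ oA].
  by rewrite -GRing.signr_odd oA GRing.expr1 GRing.mulN1r.
have evenE : (\sum_(A : {set {set G}} | (A \subset edges G) && ~~ odd #|A|)
    (-1) ^+ #|A| * #|flat s A|%:Z = (\sum_(A : {set {set G}} |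
    (A \subset edges G) && ~~ odd #|A|) #|flat s A|)%:Z)%R.
  rewrite (big_morph Posz PoszD (erefl _)); apply: eq_bigr => A /andP[_ oA].
  by rewrite -GRing.signr_odd (negbTE oA) GRing.expr0 GRing.mul1r.
rewrite oddE evenE -/(colorings s).
set x := #|_|; set y := (\sum_(A | _ && odd _) _)%N; set z := (\sum_(A | _) _)%N.
by move: x y z => x y z; lia.
Qed.

(** Subtract the identities for the two gains. All defects are nonnegative by [card_flat_le], so
    among the odd sets only [C] is kept, and the even sets bound the loss. *)
Lemma colorings_ge s C : C \subset edges G -> odd #|C| ->
  #|colorings gain1| + #|flat gain1 C| <= #|colorings s| + #|flat s C| +
  \sum_(A : {set {set G}} | (A \subset edges G) && ~~ odd #|A|)
     (#|flat gain1 A| - #|flat s A|).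
Proof.
move=> CE oC.
have split P : \sum_(A : {set {set G}} | P A) #|flat gain1 A| =
    \sum_(A | P A) #|flat s A| + \sum_(A | P A) (#|flat gain1 A| - #|flat s A|).
  by rewrite -big_split /=; apply: eq_bigr => A _; rewrite subnKC ?card_flat_le.
have := colorings_inclusion_exclusion s; have := colorings_inclusion_exclusion gain1.
rewrite !split; set T := \sum_(A | _ && odd _) (_ - _).
have : #|flat gain1 C| - #|flat s C| <= T.
  by rewrite /T (bigD1 C) ?CE ?oC //= leq_addr.
have := card_flat_le s C; clear.
move: #|colorings _| #|colorings s| #|flat _ C| #|flat s C|.
move: T (\sum_(A | _) _) (\sum_(A | _) _) (\sum_(A | _) _); lia.
Qed.

End Colorings.

(** * Labelled covers *)

Section Covers.
Variables (G H : sgraph) (m : nat) (L : G -> {set H}).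
Hypothesis coverL : is_cover L.
Implicit Types (x y : G) (a b : H) (i j : 'I_m).

Lemma cover_list_inj a x y : a \in L x -> a \in L y -> x = y.
Proof.
move=> ax ay; have /and3P[_ /trivIsetP tI _] := Defs.cover_partition coverL.
apply/eqP/negPn/negP => xy.
have /disjoint_setI0 E := tI (L x) (L y) (imset_f _ isT) (imset_f _ isT)
  (contra_neq (cover_inj coverL (x1 := x) (x2 := y)) xy).
by have := in_set0 a; rewrite -E inE ax ay.
Qed.

Lemma cover_matching x y a b b' : adj x y -> a \in L x -> b \in L y -> b' \in L y ->
  adj a b -> adj a b' -> b = b'.
Proof.
move=> xy ax bx b'x ab ab'; have [_ /trivIsetP tI] := cover_adj coverL xy.
have E : [set a; b] = [set a; b'].
  apply/eqP/negPn/negP => ne.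
  have : [disjoint [set a; b] & [set a; b']].
    by apply: tI ne; apply/imset2P; [exists a b | exists a b']; rewrite ?inE ?bx ?b'x.
  by move/disjoint_setI0/setP/(_ a); rewrite !inE eqxx.
by case/set2_inj: E => -[] // E1 E2; rewrite E2 adj_irrefl in ab.
Qed.

(** Colourings of the cover written as an index in each list. They avoid the edges of [H] only,
    whereas [colorings s] avoids the completed matchings. *)
Definition transversals (phi : G -> 'I_m -> H) : {set {ffun G -> 'I_m}} :=
  [set f : {ffun G -> 'I_m} |
    [forall x, forall y, adj x y ==> ~~ adj (phi x (f x)) (phi y (f y))]].

Lemma card_transversals_le (phi : G -> 'I_m -> H) :
  (forall x, injective (phi x)) -> (forall x i, phi x i \in L x) ->
  #|transversals phi| <= P_DP L.
Proof.
move=> phi_inj phiL; pose I (f : {ffun G -> 'I_m}) := [set phi x (f x) | x : G].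
have phiE x y i j : phi x i = phi y j -> x = y.
  by move=> E; apply: (cover_list_inj (phiL x i)); rewrite E.
have injI : injective I.
  move=> f g E; apply/ffunP => x.
  have : phi x (f x) \in I g by rewrite -E imset_f.
  case/imsetP => y _ Exy; have xy := phiE _ _ _ _ Exy; subst y.
  exact: phi_inj Exy.
rewrite -(card_imset _ injI); apply: subset_leq_card; apply/subsetP => _ /imsetP[f + ->].
rewrite !inE => /forallP fT; apply/andP; split; last first.
  by rewrite card_imset // => x y /phiE.
apply/forall_inP => _ /imsetP[x _ ->]; apply/forall_inP => _ /imsetP[y _ ->].
have [->|xy] := eqVneq x y; first by rewrite adj_irrefl.
have [axy|naxy] := boolP (adj x y); first by have /forallP/(_ y) := fT x; rewrite axy.
apply/negP => ab; have := cover_nonadj coverL xy naxy.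
move/setP/(_ [set phi x (f x); phi y (f y)]); rewrite in_set0.
by move/negbT/negP; apply; apply/imset2P; exists (phi x (f x)) (phi y (f y));
  rewrite ?inE ?phiL.
Qed.

(** The last clause is only an implication because the matchings of the cover may be imperfect. *)
Definition labelling (phi : G -> 'I_m -> H) (s : G -> G -> {perm 'I_m}) :=
  [/\ gain s, forall x, injective (phi x), forall x i, phi x i \in L x
    & forall x y i j, adj x y -> adj (phi x i) (phi y j) -> j = s x y i].

Lemma exists_labelling : (forall x, #|L x| = m) -> exists phi s, labelling phi s.
Proof.
move=> Lm; pose phi x i := enum_val (cast_ord (esym (Lm x)) i).
have phi_inj x : injective (phi x) by move=> i j /enum_val_inj/cast_ord_inj.
have phiL x i : phi x i \in L x by apply: enum_valP.
pose ext x y (p : {perm 'I_m}) :=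
  [forall i, forall j, adj (phi x i) (phi y j) ==> (p i == j)].
(* The default 1 is never taken for adjacent vertices, by [perm_extend]. *)
pose p x y := odflt 1%g [pick p | ext x y p].
have pP x y i j : adj x y -> adj (phi x i) (phi y j) -> p x y i = j.
  move=> xy ij; rewrite /p; case: pickP => [r|no] /=.
    by move/forallP/(_ i)/forallP/(_ j); rewrite ij => /eqP.
  have [||r hr] := @perm_extend _ (fun i j => adj (phi x i) (phi y j)).
  - by move=> k l l' kl kl'; apply: (phi_inj y); apply: (cover_matching xy) kl kl'.
  - move=> k k' l kl k'l; apply: (phi_inj x).
    have yx : adj y x by rewrite adj_sym.
    by apply: (cover_matching yx (phiL y l)) => //; rewrite adj_sym.
  have := no r; rewrite /ext; case/forallP => k; apply/forallP => l; apply/implyP => kl.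
  by apply/eqP/hr.
(* Choosing the permutation for one orientation of each pair, by rank, and inverting it for the
   other makes [s] a gain. *)
pose s x y := if enum_rank x < enum_rank y then p x y
              else if enum_rank y < enum_rank x then (p y x)^-1%g else 1%g.
exists phi, s; split=> //.
  by move=> x y; rewrite /s; case: ltngtP => _; rewrite ?invgK ?invg1.
move=> x y i j xy ij; rewrite /s; case: ltngtP => [_|_|E].
- by rewrite (pP x y i j).
- by rewrite -(pP y x j i) ?permK // adj_sym.
- by move: xy; rewrite (enum_rank_inj (ord_inj E)) adj_irrefl.
Qed.

Lemma labelling_regauge phi s (g : G -> {perm 'I_m}) : labelling phi s ->
  labelling (fun x i => phi x (g x i)) (regauge s g).
Proof.
case=> gs phi_inj phiL phi_adj; split=> //; first exact: regauge_gain.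
  by move=> x i j /phi_inj/perm_inj.
by move=> x y i j xy /(phi_adj _ _ _ _ xy); rewrite !permM => <-; rewrite permK.
Qed.

Lemma colorings_transversals phi s : labelling phi s ->
  colorings s \subset transversals phi.
Proof.
case=> gs _ _ phi_adj; apply/subsetP => f; rewrite !inE => /forall_inP h.
apply/forallP => x; apply/forallP => y; apply/implyP => xy.
have := h [set x; y]; rewrite mem_edges agreesE ?adj_neq // => /(_ xy).
by apply: contra => /(phi_adj _ _ _ _ xy) ->.
Qed.

Lemma canonical_isomorphic phi s : (forall x, #|L x| = m) -> labelling phi s ->
  (forall x y, adj x y -> s x y = 1%g) ->
  (forall x y i, adj x y -> adj (phi x i) (phi y i)) ->
  isomorphic H (canonical_graph G m).
Proof.
move=> Lm [gs phi_inj phiL phi_adj] s1 phi1.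
pose psi (p : G * 'I_m) := phi p.1 p.2.
have psi_inj : injective psi.
  move=> [x i] [y j]; rewrite /psi /= => E.
  have xy : x = y by apply: (cover_list_inj (phiL x i)); rewrite E.
  by subst y; rewrite (phi_inj _ _ _ E).
have surj a : exists p, a = psi p.
  have : a \in cover [set L u | u : G].
    by have /and3P[/eqP-> _ _] := Defs.cover_partition coverL; rewrite inE.
  rewrite cover_imset => /bigcupP[x _].
  have -> : L x = [set phi x i | i : 'I_m].
    apply/esym/eqP; rewrite eqEcard card_imset // card_ord Lm leqnn andbT.
    by apply/subsetP => _ /imsetP[i _ ->].
  by case/imsetP => i _ ->; exists (x, i).
have cardH : #|H| <= #|{: G * 'I_m}|.
  rewrite -cardsT; apply: leq_trans (leq_imset_card psi _).
  by apply: subset_leq_card; apply/subsetP => a _; have [p ->] := surj a; apply: imset_f.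
have [psi' psiK psi'K] := inj_card_bij psi_inj cardH.
exists psi'; first by exists psi.
move=> a b; have [[x i] ->] := surj a; have [[y j] ->] := surj b.
rewrite !psiK /= /canonical_adj /psi /=.
have [<-|xy] := eqVneq x y.
  rewrite adj_irrefl orbF /=; apply/idP/idP => [ij|/adj_neq].
    by apply: (cover_complete coverL (u := x)); rewrite ?phiL // (inj_eq (@phi_inj x)).
  by apply: contraNneq => ->.
have [axy|naxy] /= := boolP (adj x y).
  apply/eqP/idP => [<-|/(phi_adj _ _ _ _ axy)]; first exact: phi1.
  by rewrite s1 // perm1.
apply/esym/negP => ab; have := cover_nonadj coverL xy naxy.
move/setP/(_ [set phi x i; phi y j]); rewrite in_set0.
by move/negbT/negP; apply; apply/imset2P; exists (phi x i) (phi y j); rewrite ?inE ?phiL.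
Qed.

(* Colouring both ends of the missing edge with its index i, and all other
   vertices with distinct colours other than i, gives a transversal that is
   not a proper colouring. *)
Lemma missing_edge_transversal phi s u v i : #|G| < m -> labelling phi s ->
  (forall x y, adj x y -> s x y = 1%g) ->
  adj u v -> ~~ adj (phi u i) (phi v i) ->
  #|colorings (@gain1 G m)| < #|transversals phi|.
Proof.
move=> Gm [gs phi_inj phiL phi_adj] s1 uv nadj.
have Gm1 : #|G| <= m.-1 by rewrite -ltnS (ltn_predK Gm).
pose k x := lift i (widen_ord Gm1 (enum_rank x)).
pose f := [ffun x => if x \in [set u; v] then i else k x].
have ki x : (k x == i) = false by rewrite eq_sym; apply/negbTE/neq_lift.
have k_inj : injective k.
  by move=> x y /lift_inj/(congr1 val)/= E; apply/enum_rank_inj/ord_inj.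
apply: proper_card; apply/properP; split.
  apply/subsetP => g; rewrite !inE => /forall_inP h.
  apply/forallP => x; apply/forallP => y; apply/implyP => xy.
  have := h [set x; y]; rewrite mem_edges agreesE ?adj_neq //; last exact: gain1_gain.
  move/(_ xy); apply: contra => /(phi_adj _ _ _ _ xy) ->.
  by rewrite s1.
exists f.
  rewrite inE; apply/forallP => x; apply/forallP => y; apply/implyP => xy.
  apply/negP => axy; have := phi_adj _ _ _ _ xy axy; rewrite s1 // perm1 !ffunE.
  move: axy; rewrite !ffunE.
  have [xe|xe] := boolP (x \in _); have [ye|ye] := boolP (y \in _) => axy E.
  - move: (adj_neq xy) axy; case/set2P: xe => ->; case/set2P: ye => ->;
      rewrite ?eqxx // => _; apply/negP => //.
    by rewrite adj_sym.
  - by have := ki y; rewrite E eqxx.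
  - by have := ki x; rewrite E eqxx.
  - by move/k_inj: E (adj_neq xy) => ->; rewrite eqxx.
rewrite inE; apply/forall_inPn; exists [set u; v]; first by rewrite mem_edges.
by rewrite negbK agreesE ?adj_neq ?perm1 ?ffunE ?set21 ?set22 //; apply: gain1_gain.
Qed.

End Covers.

Lemma card_colorings_gain1 (G : sgraph) m : #|colorings (@gain1 G m)| = P_chrom G m.
Proof.
apply: eq_card => f; rewrite !inE; apply/forall_inP/forallP => h.
  move=> x; apply/forallP => y; apply/implyP => xy; have := h [set x; y].
  rewrite mem_edges agreesE ?adj_neq ?perm1 //; last exact: gain1_gain.
  by rewrite eq_sym; apply.
move=> e /edgesP[x [y [xy ->]]]; rewrite agreesE ?adj_neq ?perm1 //; last exact: gain1_gain.
by have /forallP/(_ y) := h x; rewrite xy eq_sym.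
Qed.

(** * The dominant cycle *)

Lemma tree_edges_bridges (G : sgraph) (F : {set {set G}}) x y :
  acyclic (spanning_subgraph F) -> spanning_adj F x y ->
  ~~ connect (spanning_adj (F :\ [set x; y])) x y.
Proof.
move=> acF xy; apply/negP => /connectP[_ /shortenP[p pp up _] yE]; subst y.
have [sc cc _] := closing_cycle xy up pp.
by have := acF (x :: p); rewrite /is_cycle sc /ucycleb cc up.
Qed.

(** The path shortens to a simple one, which the edge xy closes to a cycle. *)
Lemma path_girth (G : sgraph) (A : {set {set G}}) x y p c :
  A \subset edges G -> spanning_adj A x y ->
  path (spanning_adj (A :\ [set x; y])) x p -> last x p = y ->
  shortest_cycle [set x; y] c -> size c <= (size p).+1.
Proof.
move=> AE xy /shortenP[p' pp' up' sub] yE [_ minc]; rewrite -yE in xy pp' minc.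
have [sc cc eC] := closing_cycle xy up' pp'.
apply: leq_trans (minc (x :: p') _) _; last first.
  by rewrite /= ltnS; apply: uniq_leq_size; [case/andP: up' | apply: sub].
rewrite /cycle_through eC /is_cycle sc /ucycleb up' !andbT.
by apply: sub_cycle cc => a b /(spanning_adj_subset AE); rewrite spanning_adj_edges.
Qed.

Section DominantCycle.
Variables (G : sgraph) (m q : nat) (s : G -> G -> {perm 'I_m}).
Variables (e : 'I_q -> {set G}) (C : 'I_q -> seq G) (v : {set G} -> G).
Hypothesis m_gt0 : 0 < m.
Hypothesis gs : gain s.
Hypothesis vE : forall d, d \in edges G -> v d \in d.
Hypothesis e_inj : injective e.
Hypothesis displ_out : forall d, d \in edges G -> d \notin [set e j | j : 'I_q] ->
  displ s d = set0.
Hypothesis shortC : forall j, shortest_cycle (e j) (C j).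
Hypothesis monoC : forall k j : 'I_q, k <= j -> size (C k) <= size (C j).
Hypothesis oddC : forall j, odd (size (C j)).
Hypothesis C_prec : forall j d, d \in cycle_edges (C j) -> displ s d != set0 ->
  exists2 k : 'I_q, k <= j & d = e k.

(** The w(e_j) and, on the next line, t(A) of the overview; the truncated subtraction is exact by
    [card_flat_le]. *)
Local Notation weight j := (#|displ s (e j)| * m ^ (#|G| - size (C j))).
Local Notation defect A := (#|flat (@gain1 G m) A| - #|flat s A|).

(** By [C_prec], the other edges of C_j that move a colour are some e_k with k < j. Their cycles are
    no longer than C_j, so their terms in [cycle_defect_ge] are at most their own weights. *)
Lemma cycle_weight_le j :
  weight j <= defect (cycle_edges (C j)) + \sum_(k < q | k < j) weight k.
Proof.
have [/andP[cyc eC] _] := shortC j.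
have vC d : d \in cycle_edges (C j) -> v d \in d.
  by move=> dC; apply/vE/(subsetP (cycle_edges_edges cyc)).
have le1 := cycle_defect_ge m_gt0 gs cyc eC vC.
suff le2 : \sum_(d in cycle_edges (C j) :\ e j) #|displ s d| * m ^ (#|G| - size (C j)) <=
    \sum_(k < q | k < j) weight k.
  move: le1 le2; move: (weight j) (\sum_(d in _) _) (\sum_(k < q | _) _).
  by move: #|flat s (cycle_edges (C j))| #|flat (@gain1 G m) (cycle_edges (C j))|; lia.
rewrite big_mkcond.
apply: (@leq_trans (\sum_d \sum_(k < q | k < j) (if d == e k then weight k else 0))).
  apply: leq_sum => d _; case: ifP => // /setD1P[dej dC].
  have [->|dn0] := eqVneq (displ s d) set0; first by rewrite cards0.
  have [k kj dk] := C_prec dC dn0.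
  have ltkj : k < j.
    by rewrite ltn_neqAle kj andbT; apply: contraNneq dej => /ord_inj <-; rewrite dk.
  rewrite (bigD1 k) //= dk eqxx; apply: leq_trans (leq_addr _ _).
  by rewrite leq_mul2l leq_pexp2l ?orbT // leq_sub2l // monoC.
rewrite exchange_big /=; apply: leq_sum => k _.
by rewrite -big_mkcond big_pred1_eq.
Qed.

(** Only edges of nontrivial gain on a cycle of [A] count. Each of these is some e_j, and
    [path_girth] supplies the length bound for [even_fiber_bound]. *)
Lemma even_defect_le (A : {set {set G}}) : A \subset edges G -> ~~ odd #|A| ->
  m * defect A <= \sum_j weight j.
Proof.
move=> AE evenA.
(* As [e] is injective, this sum has at most one term: it inverts [e], with value 0 off its
   image. *)
pose B d := \sum_(j | d == e j) m ^ (#|G| - size (C j)).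
have BE j : B (e j) = m ^ (#|G| - size (C j)).
  by rewrite /B (big_pred1 j) // => k; rewrite /= (inj_eq e_inj) eq_sym.
have vA d : d \in A -> v d \in d by move=> dA; apply/vE/(subsetP AE).
have le1 : m * #|flat (@gain1 G m) A| <= m * #|flat s A| + \sum_(d in A) #|displ s d| * B d.
  apply: (flat_defect_le gs AE vA) => x y i xyA s1 cn; have /andP[xy xyA'] := xyA.
  have : [set x; y] \in [set e j | j : 'I_q].
    apply: contraNT (displ_neq0 gs xy s1) => /(displ_out (subsetP AE _ xyA')) ->.
    exact: eqxx.
  case/imsetP => j _ xyE; rewrite xyE BE.
  apply: (even_fiber_bound m_gt0 i AE xyA cn _ (oddC j) evenA) => p pp yE.
  by apply: (path_girth AE xyA pp yE); rewrite xyE.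
rewrite mulnBr leq_subLR; apply: leq_trans le1 _.
rewrite leq_add2l [leqRHS](_ : _ = \sum_(d : {set G}) \sum_(j | d == e j) weight j).
  rewrite big_mkcond; apply: leq_sum => d _; case: ifP => // _.
  by rewrite /B big_distrr /=; apply: leq_sum => j /eqP ->.
by rewrite (exchange_big_dep predT) //=; apply: eq_bigr => j _; rewrite big_pred1_eq.
Qed.

(** For the dominant C_j with defect t, the total even loss T satisfies m T <= 2^|E| W <= 2^|E| 2^q
    t < m t, so the gain t exceeds T. *)
Lemma colorings_gt : 2 ^ q * 2 ^ #|edges G| < m -> (exists j, displ s (e j) != set0) ->
  #|colorings (@gain1 G m)| < #|colorings s|.
Proof.
move=> mbig [j0 dj0].
have W0 : 0 < \sum_j weight j.
  by rewrite (bigD1 j0) //= addn_gt0 muln_gt0 card_gt0 dj0 expn_gt0 m_gt0.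
have [j Wj] := exists_dominant cycle_weight_le W0.
have [/andP[cyc _] _] := shortC j.
have /andP[sc /andP[_ uc]] := cyc.
have oC : odd #|cycle_edges (C j)| by rewrite card_cycle_edges.
have le1 := colorings_ge s (cycle_edges_edges cyc) oC.
set T := \sum_(A : {set {set G}} | _) _ in le1.
have le2 : m * T <= 2 ^ #|edges G| * \sum_k weight k.
  rewrite /T big_distrr /= -card_powerset -sum_nat_const.
  rewrite [leqRHS](bigID (fun A : {set {set G}} => ~~ odd #|A|)) /=.
  apply: leq_trans (leq_addr _ _).
  rewrite [leqRHS](eq_bigl (fun A : {set {set G}} => (A \subset edges G) && ~~ odd #|A|)).
    by apply: leq_sum => A /andP[AE oA]; apply: even_defect_le.
  by move=> A; rewrite inE.
have := card_flat_le s (cycle_edges (C j)).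
move: le1 le2 Wj W0 mbig; move: T (\sum_k weight k) (2 ^ q) (2 ^ #|edges G|) => T W Q K.
move: #|colorings (@gain1 G m)| #|colorings s| #|flat s _| #|flat (@gain1 G m) _|.
move=> N1 N0 b a le1 le2 Wj W0 mbig le3.
have t0 : 0 < a - b by rewrite lt0n; apply: contraTneq W0 => t0; rewrite -leqNgt; nia.
rewrite ltnNge; apply/negP => le4.
have : m * (a - b) <= m * T by rewrite leq_mul2l; lia.
have : K * W <= Q * K * (a - b) by nia.
have : Q * K * (a - b) < m * (a - b) by rewrite ltn_pmul2r.
lia.
Qed.

End DominantCycle.

Theorem theorem1p3 (G : sgraph) : DP_good G -> DP_star G.
Proof.
case=> F [[FE [_ acF]]]; set q := _ - _; case=> e [e_inj e_im e_mono e_good].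
have cyc j : exists c : seq G, shortest_cycle (e j) c /\
    cycle_edges c \subset F :|: [set e k | k : 'I_q & k <= j].
  by have [_ [c]] := e_good j; exists c.
have [C shortC] := fin_all_exists cyc.
(* The summand [#|G|] leaves enough colours for [missing_edge_transversal]; the other gives the
   bound of [colorings_gt]. *)
exists (#|G| + 2 ^ q * 2 ^ #|edges G|).+1 => m le_m H L [coverL Lm] not_iso.
have m_gt0 : 0 < m by apply: leq_trans le_m.
have Gm : #|G| < m by apply: leq_trans le_m; rewrite ltnS leq_addr.
have mbig : 2 ^ q * 2 ^ #|edges G| < m by apply: leq_trans le_m; rewrite ltnS leq_addl.
have [phi0 [s0 lab0]] := exists_labelling coverL Lm.
have gs0 : gain s0 by case: lab0.
(* Every tree edge is a bridge of the tree, so the gauge lemma applies with [A] equal to [F]. *)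
have [g [gF _]] := exists_gauge gs0 (subxx F) (fun x y => tree_edges_bridges acF).
have lab := labelling_regauge g lab0.
move: (fun x i => _) (regauge s0 g) lab gF => phi s lab sF.
have [gs phi_inj phiL _] := lab.
rewrite -card_colorings_gain1.
apply: leq_trans (card_transversals_le coverL phi_inj phiL).
have [/forallP s1|/forallPn[x /forallPn[y]]] :=
    boolP [forall x, forall y, adj x y ==> (s x y == 1%g)].
  have {}s1 x y : adj x y -> s x y = 1%g.
    by move=> xy; have /forallP/(_ y) := s1 x; rewrite xy => /eqP.
  have [/forallP phi1|/forallPn[u /forallPn[v /forallPn[i]]]] :=
      boolP [forall x, forall y, forall i, adj x y ==> adj (phi x i) (phi y i)].
    case: not_iso; apply: (canonical_isomorphic coverL Lm lab s1) => x y i xy.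
    by have /forallP/(_ y)/forallP/(_ i) := phi1 x; rewrite xy.
  by rewrite negb_imply => /andP[uv nadj]; apply: missing_edge_transversal lab s1 uv nadj.
rewrite negb_imply => /andP[xy sxy].
apply: leq_trans (subset_leq_card (colorings_transversals lab)).
have displF d : d \in F -> displ s d = set0.
  move=> dF; have [a [b [ab dE]]] := edgesP (subsetP FE d dF).
  apply/setP => i; rewrite dE displE ?adj_neq // in_set0 sF ?perm1 ?eqxx //.
  by rewrite /spanning_adj adj_neq // -dE.
have displ_out d : d \in edges G -> d \notin [set e j | j : 'I_q] -> displ s d = set0.
  by move=> dE; rewrite e_im inE dE andbT negbK => /displF.
have girthC j : edge_girth (e j) = Some (size (C j)).
  by apply: edge_girthP; have [] := shortC j.
(* An arbitrary end of each edge; the default [x] concerns the empty set only. *)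
pose v (d : {set G}) := odflt x [pick z in d].
have vE d : d \in edges G -> v d \in d.
  case/edgesP => a [b [_ ->]]; rewrite /v; case: pickP => //= /(_ a).
  by rewrite set21.
apply: (@colorings_gt G m q s e C v) => //.
- by move=> j; have [] := shortC j.
- by move=> k j /e_mono; rewrite !girthC.
- by move=> j; have [] := e_good j; rewrite girthC.
- move=> j d dC dn0; have [_ /subsetP/(_ d dC)] := shortC j.
  rewrite inE => /orP[/displF dF|/imsetP[k kj ->]]; first by rewrite dF eqxx in dn0.
  by exists k; rewrite // inE in kj.
(* The edge xy has nontrivial gain, hence lies outside the tree and is some e_j. *)
- have : [set x; y] \in [set e j | j : 'I_q].
    apply: contraNT (displ_neq0 gs (adj_neq xy) sxy) => nE.
    by apply/eqP/displ_out; rewrite ?mem_edges.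
  by case/imsetP => j _ E; exists j; rewrite -E displ_neq0 // adj_neq.
Qed.
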